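(* Let $\hbar>0$, let $n$ be an even positive integer, and let $\mathbb{R}^n$ be equipped with the Euclidean scalar product $g$, a linear map $J$ with $J^2=-\mathrm{id}$ and $J^T=-J$, and the symplectic form $\omega(v,w)=g(Jv,w)$. Then for all $v,w,u\in\mathbb{R}^n$ (in each case, all those which are not the integration variable) the following hold. 1) If $g_1(v,w)=\omega(v,w)-\frac{i}{2}\|v-w\|^2$, then $$\int_{\mathbb{R}^n}e^{-\frac{i}{\hbar}g_1(v,w)}\,dv=(2\pi\hbar)^{\frac n2}e^{-\frac{1}{2\hbar}\|w\|^2}.$$ 2) If $g_2(v,w,u)=-\omega(v,w+u)-\frac{i}{2}\|v\|^2$, then $$\int_{\mathbb{R}^n}e^{-\frac{i}{\hbar}g_2(v,w,u)}\,dv=(2\pi\hbar)^{\frac n2}e^{-\frac{1}{2\hbar}\|w+u\|^2}.$$ 3) If $g_3(v,w,u)=\omega(v,w)+\omega(w,u)-\frac{i}{2}\|v-w\|^2-\frac{i}{2}\|w-u\|^2$, then $$\int_{\mathbb{R}^n}e^{-\frac{i}{\hbar}g_3(v,w,u)}\,dw=(\pi\hbar)^{\frac n2}e^{-\frac{i}{\hbar}g_1(v,u)},$$ where $g_1(v,u)=\omega(v,u)-\frac{i}{2}\|v-u\|^2$.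
   Context: Here $g(v,w)=v^T\cdot w$ is the standard Euclidean scalar product on $\mathbb{R}^n$, $\|v\|^2=g(v,v)$, and $J$ is a linear complex structure compatible with $g$, so that $J$ is orthogonal and $\omega$ is a $J$-invariant, non-degenerate, skew-symmetric bilinear form. The quantum parameter $\hbar$ is treated as a positive real number, and $dv$, $dw$ denote Lebesgue measure on $\mathbb{R}^n$. *)

(* Defs.v *)
From HB Require Import structures.
From mathcomp Require Import all_boot all_order all_algebra.
From mathcomp Require Import complex.
From mathcomp Require Import all_classical all_reals all_analysis.

Set Implicit Arguments.
Unset Strict Implicit.
Unset Printing Implicit Defensive.

Import Order.TTheory GRing.Theory Num.Theory.
Import numFieldNormedType.Exports.

Local Open Scope classical_set_scope.
Local Open Scope ring_scope.

Section tuple_product_measure.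
Context {R : realType} {n : nat}.
Variable mu : {sigma_finite_measure set (n.-tuple R) -> \bar R}.

Definition cons_pair (p : R * n.-tuple R) : n.+1.-tuple R :=
  [tuple of p.1 :: p.2].

Let uncons (t : n.+1.-tuple R) : R * n.-tuple R :=
  (thead t, [tuple of behead t]).

Lemma measurable_cons_pair : measurable_fun [set: _] cons_pair.
Proof. exact: measurable_cons. Qed.

Let measurable_uncons : measurable_fun [set: _] uncons.
Proof.
apply: measurable_fun_pair; first exact: measurable_tnth.
exact: measurable_behead.
Qed.

Let cons_pairK : cancel cons_pair uncons.
Proof. by case=> x t; rewrite /uncons /=; congr (_, _); exact: val_inj. Qed.

Definition lebesgue_cons : set (n.+1.-tuple R) -> \bar R :=
  pushforward (lebesgue_measure \x mu)%E cons_pair.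

Let lebesgue_cons0 : lebesgue_cons set0 = 0%E.
Proof. by rewrite /lebesgue_cons /pushforward preimage_set0 measure0. Qed.

Let lebesgue_cons_ge0 A : (0 <= lebesgue_cons A)%E.
Proof. by rewrite /lebesgue_cons /pushforward; apply: measure_ge0. Qed.

Let lebesgue_cons_sigma_additive : semi_sigma_additive lebesgue_cons.
Proof.
move=> F mF tF mUF; rewrite /lebesgue_cons /pushforward preimage_bigcup.
apply: measure_semi_sigma_additive.
- by move=> k; rewrite -[X in measurable X]setTI; exact: measurable_cons_pair.
- apply/trivIsetP => i j _ _ ij; rewrite -preimage_setI.
  by move/trivIsetP : tF => /(_ _ _ _ _ ij) ->//; rewrite preimage_set0.
- rewrite -preimage_bigcup -[X in measurable X]setTI.
  exact: measurable_cons_pair.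
Qed.

HB.instance Definition _ := isMeasure.Build _ _ _ lebesgue_cons
  lebesgue_cons0 lebesgue_cons_ge0 lebesgue_cons_sigma_additive.

Let lebesgue_cons_sigma_finite : sigma_finite setT lebesgue_cons.
Proof.
have /sigma_finiteP[F [FT ndF Foo]] := sigma_finiteT (@lebesgue_measure R).
have /sigma_finiteP[G [GT ndG Goo]] := sigma_finiteT mu.
exists (fun k => uncons @^-1` (F k `*` G k)).
  rewrite -preimage_bigcup -[LHS](preimage_setT uncons); congr (_ @^-1` _).
  apply/esym; rewrite -subTset => -[x y] _.
  have [i _ Fx] : (\bigcup_i F i) x by rewrite -FT.
  have [j _ Gy] : (\bigcup_i G i) y by rewrite -GT.
  exists (maxn i j) => //; split.
    by move: x Fx; exact/subsetPset/ndF/leq_maxl.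
  by move: y Gy; exact/subsetPset/ndG/leq_maxr.
move=> k; have [mF Fk] := Foo k; have [mG Gk] := Goo k; split.
  rewrite -[X in measurable X]setTI; apply: measurable_uncons => //.
  exact: measurableX.
rewrite /lebesgue_cons /pushforward -comp_preimage.
rewrite (_ : uncons \o cons_pair = id); last exact/funext/cons_pairK.
by rewrite preimage_id product_measure1E// lte_mul_pinfty// ge0_fin_numE.
Qed.

HB.instance Definition _ := Measure_isSigmaFinite.Build _ _ _ lebesgue_cons
  lebesgue_cons_sigma_finite.

End tuple_product_measure.

(* Lebesgue measure on R^n as the n-fold product of Lebesgue measure on R, on
   the product sigma-algebra (= Borel sets) of n.-tuple R. *)
Fixpoint lebesgue_tuple (R : realType) (n : nat) :
    {sigma_finite_measure set (n.-tuple R) -> \bar R} :=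
  match n with
  | 0 => \d_([tuple] : 0.-tuple R)
  | m.+1 => lebesgue_cons (lebesgue_tuple R m)
  end.

Lemma lebesgue_tuple_box (R : realType) (n : nat) (A : 'I_n -> set R) :
  (forall i, measurable (A i)) ->
  lebesgue_tuple R n [set t | forall i, A i (tnth t i)] =
  (\prod_(i < n) lebesgue_measure (A i))%E.
Proof.
elim: n A => [A _|n IHn A mA].
  by rewrite big_ord0 /= diracE mem_set // => -[].
rewrite big_ord_recl -IHn; last by move=> i; exact: mA.
rewrite [LHS]/= /lebesgue_cons /pushforward.
rewrite (_ : _ @^-1` _ =
  A ord0 `*` [set t : n.-tuple R | forall i, A (lift ord0 i) (tnth t i)]).
  rewrite product_measure1E //; first exact: mA.
  rewrite (_ : [set t | _] =
    \bigcap_(i in [set: 'I_n]) ((@tnth n R ^~ i) @^-1` A (lift ord0 i))).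
    apply: fin_bigcap_measurable => // i _.
    by rewrite -[X in measurable X]setTI; exact: measurable_tnth.
  by apply/seteqP; split => t /= h i; [move=> _|]; exact: h.
apply/seteqP; split => -[x t] /=.
  move=> h; split; first exact: (h ord0).
  by move=> i; have := h (lift ord0 i); rewrite tnthS.
by case=> h0 h i; case: (unliftP ord0 i) => [j|] ->; rewrite ?tnthS //; exact: h.
Qed.

Definition col_of_tuple (R : realType) (n : nat) (t : n.-tuple R) : 'cV[R]_n :=
  \col_i tnth t i.

(* [cintegral] is total (a non-integrable part may get a default value), so it
   is meaningful only together with [cintegrable]. *)
Definition cintegrable (R : realType) (n : nat) (F : 'cV[R]_n -> R[i]) : Prop :=
  (lebesgue_tuple R n).-integrable setT
    (fun t => (complex.Re (F (col_of_tuple t)))%:E) /\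
  (lebesgue_tuple R n).-integrable setT
    (fun t => (complex.Im (F (col_of_tuple t)))%:E).

Definition cintegral (R : realType) (n : nat) (F : 'cV[R]_n -> R[i]) : R[i] :=
  Complex (\int[lebesgue_tuple R n]_t complex.Re (F (col_of_tuple t)))
          (\int[lebesgue_tuple R n]_t complex.Im (F (col_of_tuple t))).

Definition cexp (R : realType) (z : R[i]) : R[i] :=
  Complex (expR (complex.Re z) * cos (complex.Im z))
          (expR (complex.Re z) * sin (complex.Im z)).

Section phases.
Context {R : realType} {n : nat}.
Implicit Types v w u : 'cV[R]_n.

Definition scalar_product v w : R := (v^T *m w) 0 0.

Definition sqnorm v : R := scalar_product v v.

Variable J : 'M[R]_n.

Definition omega v w : R := scalar_product (J *m v) w.

Definition g1 v w : R[i] :=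
  (omega v w)%:C%C - 'i / 2 * (sqnorm (v - w))%:C%C.

Definition g2 v w u : R[i] :=
  - (omega v (w + u))%:C%C - 'i / 2 * (sqnorm v)%:C%C.

Definition g3 v w u : R[i] :=
  (omega v w)%:C%C + (omega w u)%:C%C
  - 'i / 2 * (sqnorm (v - w))%:C%C - 'i / 2 * (sqnorm (w - u))%:C%C.

End phases.

(* Main.v *)
Require Import Defs.
From mathcomp Require Import all_boot all_order all_algebra.
From mathcomp Require Import complex ring lra.
From mathcomp Require Import all_classical all_reals all_analysis.
From mathcomp Require Import measurable_realfun.

Set Implicit Arguments.
Unset Strict Implicit.
Unset Printing Implicit Defensive.

Import Order.TTheory GRing.Theory Num.Theory.
Import numFieldNormedType.Exports.

Local Open Scope ring_scope.

(** The three integrals are one Gaussian integral.  Since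
    [- (i / hbar) * g] has real part [- q / (2 hbar)] with [q] a sum of squared
    distances, and imaginary part linear in the integration variable, completing
    the square brings each integrand to the form
      [exp (k - |v - m|^2 / (2 a) + i <p, v>)],
    whose integral is
      [(2 pi a)^(n/2) exp (k - a |p|^2 / 2 + i <p, m>)]   ([cintegral_gauss]).
    In 1) and 2) one has [a = hbar], the centre [m] is [w], resp. [0], and [p]
    is [J w / hbar], resp. [- J (w + u) / hbar].  In 3) the sum of the two
    squared distances is centred at the midpoint of [v] and [u]
    ([sqnorm_midpoint]), so that [a = hbar / 2] and half of the exponent
    [- |v - u|^2 / (2 hbar)] comes from the square completed, the other half
    from the Fourier transform.  Orthogonality of [J] turns [|p|] back into a
    norm of the parameters and skew-symmetry of [omega] evaluates [<p, m>].

    The Gaussian formula is proved with real integrals only.  A phase [c] is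
    kept inside the cosine: the cosine with phase [c - pi / 2] is the sine, so
    real and imaginary parts are the same statement, and the phase absorbs all
    other coordinates when Fubini's theorem is applied by induction on the
    dimension ([integral_gauss_wave]).  On the line the integral
      [K p = int exp (- (x - m)^2 / (2 s^2)) cos (p (x - m) + c) dx]
    satisfies [K' = - s^2 p K]: differentiate under the integral sign and
    integrate by parts ([is_derive_integral_normal_cos]).  Hence
    [exp (s^2 p^2 / 2) K p] is constant, equal to its value at [p = 0]
    ([Rintegral_normal_cos_center]). *)

(** * Gaussian integrals on the line *)

Section real_line.
Local Open Scope classical_set_scope.
Context {R : realType}.
Notation mu := (@lebesgue_measure R).
Implicit Types m s p c x : R.

(** The boundary terms of an integration by parts over the whole line vanish:
    the fundamental theorem on [-n, n] gives [H n - H (- n)], and dominated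
    convergence lets [n] go to infinity. *)
Lemma integral_derive_eq0 (H h : R -> R) :
  continuous h -> (forall x, is_derive x 1 H (h x)) ->
  mu.-integrable [set: R] (EFin \o h) ->
  H x @[x --> +oo] --> (0 : R) -> H x @[x --> -oo] --> (0 : R) ->
  (\int[mu]_x (h x)%:E = 0)%E.
Proof.
move=> ch dH ih Hy HNy.
pose I (n : nat) : set R := `[- n%:R, n%:R].
have mI n : measurable (I n) by exact: measurable_itv.
pose h_ n : R -> \bar R := (EFin \o h) \_ (I n).
have /integrableP[mh _] := ih.
have [||||| _ _ cvgh] := @dominated_convergence _ _ _ mu setT measurableT
    h_ (EFin \o h) (abse \o (EFin \o h)).
  - move=> n; apply/(measurable_restrictT _ (mI n)).
    exact: measurable_funTS.
  - by [].
  - apply: aeW => x _; apply: (@cvg_near_cst _ _ _ (h_ ^~ x)).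
    near=> n; rewrite /h_ patchE mem_set//= /I /= in_itv/= -ler_norml.
    by near: n; exact: nbhs_infty_ger.
  - exact: integrable_abse.
  - apply: aeW => x n _ /=; rewrite /h_ patchE; case: ifP => // _.
    by rewrite abse0.
have {cvgh} : (\int[mu]_x h_ n.+1 x)%E @[n --> \oo] --> (\int[mu]_x (h x)%:E)%E.
  by move: cvgh; rewrite -(cvg_shiftS (fun n => \int[mu]_x h_ n x)%E).
have -> : (fun n => \int[mu]_x h_ n.+1 x)%E =
    (EFin \o (fun n : nat => H n.+1%:R - H (- n.+1%:R))).
  apply/funext => n; rewrite /h_ -integral_mkcond /I/=.
  have cH : continuous H.
    move=> x; apply/differentiable_continuous/derivable1_diffP.
    by have [] := dH x.
  rewrite (@continuous_FTC2 _ h H) ?EFinB//.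
  - by rewrite gtrN.
  - exact: continuous_subspaceT.
  - split => [x _||]; first exact: (@ex_derive _ _ _ _ _ _ _ (dH x)).
    + by apply: cvg_at_right_filter; exact: cH.
    + by apply: cvg_at_left_filter; exact: cH.
  - by move=> x _; rewrite derive1E; have [_ ->] := dH x.
move=> lim1.
have lim2 : EFin (H n.+1%:R - H (- n.+1%:R)) @[n --> \oo] --> (0 : R)%:E.
  apply: cvg_EFin; first exact: nearW.
  rewrite -(subr0 0); apply: cvgB.
    apply: (cvg_comp (fun n : nat => n.+1%:R) H _ Hy).
    by rewrite (cvg_shiftS (fun n => n%:R : R)); exact: cvgr_idn.
  apply: (cvg_comp (fun n : nat => - n.+1%:R) H _ HNy).
  apply/cvgNry; rewrite [X in X @ _](_ : _ = (fun n : nat => n.+1%:R)).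
    by rewrite (cvg_shiftS (fun n => n%:R : R)); exact: cvgr_idn.
  by apply/funext => n /=; rewrite !fctE opprK.
exact: (cvg_unique _ lim1 lim2).
Unshelve. all: by end_near. Qed.

Lemma normal_funE m s x : s != 0 ->
  normal_fun m s x = (normal_peak s)^-1 * normal_pdf m s x.
Proof.
by move=> s0; rewrite normal_pdfE//= mulKf// gt_eqF// normal_peak_gt0.
Qed.

Lemma integrable_normal_fun m s : s != 0 ->
  mu.-integrable [set: R] (EFin \o normal_fun m s).
Proof.
move=> s0.
have := integrableZl measurableT (normal_peak s)^-1 (integrable_normal_pdf m s).
apply: eq_integrable => // x _ /=.
by rewrite normal_funE// EFinM.
Qed.

Lemma integral_normal_fun m s : s != 0 ->
  (\int[mu]_x (normal_fun m s x)%:E = (normal_peak s)^-1%:E)%E.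
Proof.
move=> s0; under eq_integral do rewrite normal_funE// EFinM.
rewrite integralZl//; last exact: integrable_normal_pdf.
by rewrite integral_normal_pdf mule1.
Qed.

Lemma is_derive_normal_fun m s x : s != 0 ->
  is_derive x 1 (normal_fun m s) (- (x - m) / s ^+ 2 * normal_fun m s x).
Proof.
move=> s0.
have dE : is_derive x 1 (fun y => (- (s ^+ 2 *+ 2)^-1) * (y - m) ^+ 2)
    (- (x - m) / s ^+ 2).
  apply: is_derive_eq.
  rewrite /GRing.scale/= subr0.
  by field.
have -> : normal_fun m s =
    expR \o (fun y => (- (s ^+ 2 *+ 2)^-1) * (y - m) ^+ 2).
  by apply/funext => y; rewrite /normal_fun/=; congr expR; rewrite !mulNr mulrC.
apply: is_derive_eq.
by rewrite mulrC.
Qed.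

Lemma continuous_normal_fun m s : s != 0 -> continuous (normal_fun m s).
Proof.
move=> s0 x; apply/differentiable_continuous/derivable1_diffP.
by have [] := is_derive_normal_fun m x s0.
Qed.

(** A linear factor costs only a wider Gaussian.  With [t = |x - m| / (2 |s|)]
    this is [t exp (- 2 t^2) <= exp (- t^2)], that is [t <= exp (t^2)], which
    follows from [t <= 1 + t^2].  It makes the first moment integrable, as
    needed for domination when differentiating under the integral sign. *)
Lemma center_normal_fun_le m s x : s != 0 ->
  `|x - m| * normal_fun m s x <= 2 * `|s| * normal_fun m (s * Num.sqrt 2) x.
Proof.
move=> s0; rewrite /normal_fun exprMn sqr_sqrtr//.
set y := x - m; set t := `|y| / (2 * `|s|).
have s_gt0 : 0 < `|s| by rewrite normr_gt0.
have -> : `|y| = 2 * `|s| * t by rewrite /t; field; rewrite gt_eqF.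
have t2 : t ^+ 2 = y ^+ 2 / (4 * s ^+ 2).
  rewrite /t expr_div_n exprMn !real_normK ?num_real//; congr (_ / _).
  by rewrite expr2 -natrM.
have -> : - y ^+ 2 / (s ^+ 2 *+ 2) = - t ^+ 2 - t ^+ 2.
  by rewrite t2; field.
have -> : - y ^+ 2 / (s ^+ 2 * 2 *+ 2) = - t ^+ 2.
  by rewrite t2; field.
rewrite -mulrA ler_pM2l ?mulr_gt0// expRD mulrA ler_piMl ?expR_ge0//.
rewrite expRN ler_pdivrMr ?expR_gt0// mul1r (le_trans _ (expR_ge1Dx _))//.
have := sqr_ge0 (t - 2^-1); nra.
Qed.

Lemma cvgy_normal_fun m s : s != 0 ->
  normal_fun m s x @[x --> +oo] --> (0 : R).
Proof.
move=> s0.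
have sq_oo : (x - m) ^+ 2 * (s ^+ 2 *+ 2)^-1 @[x --> +oo] --> +oo.
  apply: gt0_cvgMly; first by rewrite invr_gt0 pmulrn_lgt0// exprn_even_gt0.
  apply: (cvg_comp (fun x => x - m) (fun x => x ^+ 2) _ cvgr_expr2).
  exact: cvg_addrr.
rewrite (_ : normal_fun m s =
    fun x => expR (- ((x - m) ^+ 2 * (s ^+ 2 *+ 2)^-1))).
  apply: (cvg_comp _ (fun x => expR (- x))); [exact: sq_oo|exact: cvgr_expR].
by apply/funext => y; rewrite /normal_fun mulNr.
Qed.

Lemma cvgNy_normal_fun m s : s != 0 ->
  normal_fun m s x @[x --> -oo] --> (0 : R).
Proof.
move=> s0.
have -> : normal_fun m s = normal_fun (- m) s \o -%R.
  by apply/funext => y; rewrite /normal_fun/= -sqrrN opprB opprK addrC.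
apply: (cvg_comp -%R (normal_fun (- m) s) _ (cvgy_normal_fun _ s0)).
exact/cvgNry.
Qed.

Lemma integrable_normal_funM m s (g : R -> R) : s != 0 ->
  measurable_fun [set: R] g -> (forall x, `|g x| <= 1) ->
  mu.-integrable [set: R] (fun x => (normal_fun m s x * g x)%:E).
Proof.
move=> s0 mg g1; apply: le_integrable (integrable_normal_fun m s0) => //.
- apply/measurable_EFinP/measurable_funM => //; exact: measurable_normal_fun.
- move=> x _; rewrite lee_fin normrM ler_piMr//.
Qed.

Lemma integrable_center_normal_fun m s : s != 0 ->
  mu.-integrable [set: R] (EFin \o (fun x => (x - m) * normal_fun m s x)).
Proof.
move=> s0.
have s20 : s * Num.sqrt 2 != 0 by rewrite mulf_neq0// gt_eqF// sqrtr_gt0.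
have := integrableZl measurableT (2 * `|s|) (integrable_normal_fun m s20).
apply: le_integrable => //.
- apply/measurable_EFinP/measurable_funM; first exact: measurable_funB.
  exact: measurable_normal_fun.
- move=> x _; rewrite /= lee_fin normrM (ger0_norm (normal_fun_ge0 _ _ _)).
  by rewrite (le_trans (center_normal_fun_le m x s0))// ler_norm.
Qed.

Lemma integrable_center_normal_funM m s (g : R -> R) : s != 0 ->
  measurable_fun [set: R] g -> (forall x, `|g x| <= 1) ->
  mu.-integrable [set: R] (fun x => ((x - m) * normal_fun m s x * g x)%:E).
Proof.
move=> s0 mg g1; apply: le_integrable (integrable_center_normal_fun m s0) => //.
- apply/measurable_EFinP/measurable_funM => //; apply: measurable_funM.
    exact: measurable_funB.
  exact: measurable_normal_fun.
- by move=> x _; rewrite /= lee_fin normrM ler_piMr.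
Qed.

Lemma continuous_cos_affine (p m c : R) :
  continuous (fun x => cos (p * (x - m) + c)).
Proof.
move=> x.
apply: (@continuous_comp _ _ _ (fun x => p * (x - m) + c) cos);
  last exact: continuous_cos.
apply: cvgD; last exact: cvg_cst.
apply: cvgM; first exact: cvg_cst.
by apply: cvgB; [exact: cvg_id|exact: cvg_cst].
Qed.

Lemma sin_cos_shift (y : R) : sin y = cos (y - pi / 2).
Proof. by rewrite cosB cos_pihalf sin_pihalf mulr0 mulr1 add0r. Qed.

Lemma continuous_sin_affine (p m c : R) :
  continuous (fun x => sin (p * (x - m) + c)).
Proof.
under eq_fun do rewrite sin_cos_shift -addrA.
exact: continuous_cos_affine.
Qed.

(** Integration by parts, since [(x - m) exp (- (x - m)^2 / (2 s^2))] is
    [- s^2] times the derivative of the Gaussian. *)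
Lemma normal_fun_by_parts m s p c : s != 0 ->
  \int[mu]_x (- (x - m) * normal_fun m s x * sin (p * (x - m) + c)) =
  - s ^+ 2 * p * \int[mu]_x (normal_fun m s x * cos (p * (x - m) + c)).
Proof.
move=> s0.
have iC := integrable_normal_funM m s0
  (continuous_measurable_fun (@continuous_cos_affine p m c))
  (fun x => cos_max _).
have iS := integrable_center_normal_funM m s0
  (continuous_measurable_fun (@continuous_sin_affine p m c))
  (fun x => sin_max _).
pose H x := normal_fun m s x * sin (p * (x - m) + c).
pose h1 x :=
  - (s ^+ 2)^-1 * ((x - m) * normal_fun m s x * sin (p * (x - m) + c)).
pose h2 x := p * (normal_fun m s x * cos (p * (x - m) + c)).
have ih1 : mu.-integrable [set: R] (EFin \o h1).
  exact: (integrableZl measurableT _ iS).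
have ih2 : mu.-integrable [set: R] (EFin \o h2).
  exact: (integrableZl measurableT _ iC).
have H0F (F : set_system R) : Filter F ->
    normal_fun m s x @[x --> F] --> (0 : R) -> H x @[x --> F] --> (0 : R).
  move=> FF nf0; apply: norm_cvg0.
  apply: (@squeeze_cvgr _ _ _ _ (cst 0) _ _ _ _ _ nf0); last exact: cvg_cst.
  apply: nearW => x; rewrite normr_ge0/= /H normrM ger0_norm ?normal_fun_ge0//.
  by rewrite ler_piMr ?normal_fun_ge0// sin_max.
have H0 : (\int[mu]_x (h1 x + h2 x)%:E = 0)%E.
  apply: (@integral_derive_eq0 H).
  - move=> x; apply: cvgD; apply: cvgM; try exact: cvg_cst.
      apply: cvgM; last exact: continuous_sin_affine.
      apply: cvgM; last exact: continuous_normal_fun.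
      by apply: cvgB; [exact: cvg_id|exact: cvg_cst].
    apply: cvgM; [exact: continuous_normal_fun|exact: continuous_cos_affine].
  - move=> x; have dnf := is_derive_normal_fun m x s0.
    apply: is_derive_eq.
    rewrite /h1 /h2 /GRing.scale/=.
    by field.
  - exact: (integrableD measurableT ih1 ih2).
  - by apply: H0F; exact: cvgy_normal_fun.
  - by apply: H0F; exact: cvgNy_normal_fun.
have : \int[mu]_x (h1 x + h2 x) = 0 by rewrite /Rintegral H0.
rewrite RintegralD// RintegralZl// RintegralZl//.
under [in X in _ -> X]eq_Rintegral do rewrite !mulNr -mulN1r.
rewrite RintegralZl//.
set A := Rintegral _ _ _; set B := Rintegral _ _ _.
move=> /eqP; rewrite addr_eq0 => /eqP AB.
have -> : A = s ^+ 2 * p * B; last by rewrite mulN1r !mulNr.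
by rewrite -mulrA -[p * B]opprK -AB; field.
Qed.

(** The derivative of the integrand in the frequency is dominated, uniformly in
    the frequency, by the integrable function [|x - m| exp (...)]. *)
Lemma is_derive_integral_normal_cos m s p c : s != 0 ->
  let K q := \int[mu]_x (normal_fun m s x * cos (q * (x - m) + c)) in
  is_derive p 1 K (- s ^+ 2 * p * K p).
Proof.
move=> s0 K.
pose f (q x : R) : R := normal_fun m s x * cos (q * (x - m) + c).
have df (q x : R) : is_derive q 1 (f ^~ x)
    (- (x - m) * normal_fun m s x * sin (q * (x - m) + c)).
  apply: is_derive_eq; rewrite /GRing.scale/=.
  ring.
have d1f q x : partial1of2 f q x =
    - (x - m) * normal_fun m s x * sin (q * (x - m) + c).
  by rewrite partial1of2E; have [_ ->] := df q x.
have pI : `]p - 1, p + 1[%classic p by rewrite /= in_itv/= ltrBlDr ltrDl ltr01.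
have intf q : `]p - 1, p + 1[%classic q -> mu.-integrable setT (EFin \o f q).
  move=> _; apply: (integrable_normal_funM m s0) => [|x]; last exact: cos_max.
  exact: continuous_measurable_fun (@continuous_cos_affine q m c).
have derf q x : `]p - 1, p + 1[%classic q -> [set: R] x ->
    derivable (f ^~ x) q 1.
  by move=> _ _; have [] := df q x.
have G0 x : 0 <= `|(x - m) * normal_fun m s x| by [].
have iG : mu.-integrable [set: R]
    (EFin \o (fun x => `|(x - m) * normal_fun m s x|)).
  exact: integrable_norm (integrable_center_normal_fun m s0).
have Gub q x : `]p - 1, p + 1[%classic q -> [set: R] x ->
    `|partial1of2 f q x| <= `|(x - m) * normal_fun m s x|.
  move=> _ _; rewrite d1f normrM !mulNr normrN ler_piMr//; exact: sin_max.
apply: DeriveDef.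
  exact: (derivable_under_integral measurableT pI intf derf G0 iG Gub).
rewrite -derive1E.
rewrite (differentiation_under_integral measurableT pI intf derf G0 iG Gub).
under eq_Rintegral do rewrite d1f.
exact: normal_fun_by_parts.
Qed.

(** The differential equation [K' = - s^2 p K] makes
    [exp (s^2 p^2 / 2) K p] constant. *)
Lemma Rintegral_normal_cos_center m s p c : s != 0 ->
  \int[mu]_x (normal_fun m s x * cos (p * (x - m) + c)) =
  (normal_peak s)^-1 * expR (- (s ^+ 2 * p ^+ 2 / 2)) * cos c.
Proof.
move=> s0.
pose K q := \int[mu]_x (normal_fun m s x * cos (q * (x - m) + c)).
pose E q := expR (s ^+ 2 / 2 * q ^+ 2) * K q.
have EK : E p = E 0.
  apply: is_derive_0_is_cst => q.
  have dK := is_derive_integral_normal_cos m q c s0.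
  apply: is_derive_eq; rewrite /GRing.scale/= -/(K q).
  by field.
have K0 : K 0 = (normal_peak s)^-1 * cos c.
  rewrite /K; under eq_Rintegral do rewrite mul0r add0r.
  rewrite RintegralZr//; last exact: integrable_normal_fun.
  by rewrite /Rintegral integral_normal_fun.
move: EK; rewrite /E expr0n/= mulr0 expR0 mul1r K0 => EK.
rewrite -/(K p) mulrAC -EK mulrAC -expRD.
rewrite [X in expR X](_ : _ = 0) ?expR0 ?mul1r//.
by field.
Qed.

Lemma integrable_normal_cos m s p c : s != 0 ->
  mu.-integrable [set: R]
    (fun x => (normal_fun m s x * cos (p * x + c))%:E).
Proof.
move=> s0; apply: integrable_normal_funM => // [|x]; last exact: cos_max.
have -> : (fun x => cos (p * x + c)) = (fun x => cos (p * (x - 0) + c)).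
  by apply/funext => x; rewrite subr0.
exact: continuous_measurable_fun (@continuous_cos_affine _ _ _).
Qed.

Lemma integral_normal_cos m s p c : s != 0 ->
  (\int[mu]_x (normal_fun m s x * cos (p * x + c))%:E =
  ((normal_peak s)^-1 * expR (- (s ^+ 2 * p ^+ 2 / 2)) * cos (p * m + c))%:E)%E.
Proof.
move=> s0; rewrite -(Rintegral_normal_cos_center m)//.
rewrite -[LHS]fineK; last exact/integrable_fin_num/integrable_normal_cos.
congr EFin; apply: eq_Rintegral => x _; congr (_ * cos _); ring.
Qed.

End real_line.

(** * Gaussian waves in n variables *)

Section gaussian_tuple.
Context {R : realType}.
Implicit Types (n : nat) (s c : R).

Lemma integrable_product_lebesgue n (f : R -> R) (g : n.-tuple R -> R) :
  lebesgue_measure.-integrable setT (EFin \o f) ->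
  (lebesgue_tuple R n).-integrable setT (EFin \o g) ->
  (lebesgue_measure \x lebesgue_tuple R n)%E.-integrable setT
    (fun z => (f z.1 * g z.2)%:E).
Proof.
move=> /[dup] fi /integrableP[/measurable_EFinP mf foo].
move=> /[dup] gi /integrableP[/measurable_EFinP mg goo].
apply/integrable12ltyP.
  apply/measurable_EFinP/measurable_funM; exact: measurableT_comp.
have intE x : (\int[lebesgue_tuple R n]_t `|(f x * g t)%:E| =
    `|(f x)%:E| * \int[lebesgue_tuple R n]_t `|(g t)%:E|)%E.
  rewrite -ge0_integralZl//; last exact/measurableT_comp/measurable_EFinP.
  by apply: eq_integral => t _; rewrite EFinM abseM.
rewrite /=; under eq_integral do rewrite intE.
rewrite ge0_integralZr//; last 2 first.
- exact/measurableT_comp/measurable_EFinP.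
- exact: integral_ge0.
by rewrite lte_mul_pinfty// ?integral_ge0// ge0_fin_numE// integral_ge0.
Qed.

(** Stated over [measurableTypeR R], the measurable type on which Lebesgue
    measure is defined, so that the transfer lemmas for image measures apply to
    the product measure. *)
Lemma measurable_cons_pairT n : measurable_fun setT
  (cons_pair : measurableTypeR R * n.-tuple R -> n.+1.-tuple R).
Proof. exact: measurable_cons_pair. Qed.

Lemma integrable_lebesgue_tupleS n (f : n.+1.-tuple R -> R) :
  measurable_fun setT f ->
  (lebesgue_measure \x lebesgue_tuple R n)%E.-integrable setT
    (EFin \o f \o cons_pair) ->
  (lebesgue_tuple R n.+1).-integrable setT (EFin \o f).
Proof.
move=> /measurable_EFinP mf fi.
exact: (@integrable_pushforward _ _ _ _ _ _ (@measurable_cons_pairT n)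
  (lebesgue_measure \x lebesgue_tuple R n)%E setT _ mf fi measurableT).
Qed.

Lemma integral_lebesgue_tupleS n (f : n.+1.-tuple R -> R) :
  measurable_fun setT f ->
  (lebesgue_measure \x lebesgue_tuple R n)%E.-integrable setT
    (EFin \o f \o cons_pair) ->
  (\int[lebesgue_tuple R n.+1]_t (f t)%:E =
   \int[lebesgue_measure]_x \int[lebesgue_tuple R n]_t
     (f (cons_pair (x, t)))%:E)%E.
Proof.
move=> /measurable_EFinP mf fi.
rewrite (integral12_prod_meas1 fi).
exact: (@integral_pushforward _ _ _ _ _ _ (@measurable_cons_pairT n)
  (lebesgue_measure \x lebesgue_tuple R n)%E setT _ mf fi measurableT).
Qed.

(** The phase [c] makes the family stable under fixing one coordinate, see
    [gauss_wave_cons]; it also yields the sine at [c - pi / 2]. *)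
Definition gauss_wave n (m p : 'I_n -> R) s c (t : n.-tuple R) : R :=
  \prod_(i < n) normal_fun (m i) s (tnth t i) *
  cos (\sum_(i < n) p i * tnth t i + c).

Lemma measurable_gauss_wave n (m p : 'I_n -> R) s c :
  measurable_fun [set: n.-tuple R] (gauss_wave m p s c).
Proof.
apply: measurable_funM.
  apply: measurable_prod => i _.
  apply: measurableT_comp; first exact: measurable_normal_fun.
  exact: measurable_tnth.
apply: measurableT_comp.
  exact: (continuous_measurable_fun (@continuous_cos R)).
apply: measurable_funD => //; apply: measurable_sum => i.
by apply: measurable_funM => //; exact: measurable_tnth.
Qed.

Lemma gauss_wave_cons n (m p : 'I_n.+1 -> R) s c x (t : n.-tuple R) :
  gauss_wave m p s c (cons_pair (x, t)) = normal_fun (m ord0) s x *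
   gauss_wave (m \o lift ord0) (p \o lift ord0) s (p ord0 * x + c) t.
Proof.
rewrite /gauss_wave !big_ord_recl /= -!mulrA; congr (_ * (_ * cos _)).
  by apply: eq_bigr => i _; rewrite tnthS.
rewrite addrCA addrA; congr (_ + _ + _).
by apply: eq_bigr => i _; rewrite tnthS.
Qed.

(** The wave is dominated by the bare Gaussian, which is the wave of frequency
    and phase zero and factors over the coordinates. *)
Lemma integrable_gauss_wave_cons n (m p : 'I_n.+1 -> R) s c : s != 0 ->
  (lebesgue_tuple R n).-integrable setT
    (EFin \o gauss_wave (m \o lift ord0) (fun=> 0) s 0) ->
  (lebesgue_measure \x lebesgue_tuple R n)%E.-integrable setT
    (EFin \o gauss_wave m p s c \o cons_pair).
Proof.
move=> s0 ig.
have := integrable_product_lebesgue (integrable_normal_fun (m ord0) s0) ig.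
apply: le_integrable => //.
  apply: measurableT_comp; last exact: measurable_cons_pairT.
  apply/measurable_EFinP; exact: measurable_gauss_wave.
move=> [x t] _; rewrite [in leLHS]/= gauss_wave_cons lee_fin !normrM.
rewrite ler_wpM2l// ler_wpM2l// (le_trans (cos_max _))//.
rewrite big1 => [|i _]; last exact: mul0r.
by rewrite addr0 cos0 normr1.
Qed.

Lemma integrable_gauss_wave n (m p : 'I_n -> R) s c : s != 0 ->
  (lebesgue_tuple R n).-integrable setT (EFin \o gauss_wave m p s c).
Proof.
move=> s0; elim: n m p c => [|n IHn] m p c.
  apply/integrableP; split.
    apply/measurable_EFinP; exact: measurable_gauss_wave.
  rewrite /= integral_dirac//; first by rewrite diracT mul1e ltry.
  apply/measurable_EFinP; apply: measurableT_comp => //.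
  exact: measurable_gauss_wave.
apply: integrable_lebesgue_tupleS; first exact: measurable_gauss_wave.
exact: integrable_gauss_wave_cons.
Qed.

(** Integrating out all coordinates but the first leaves a one-dimensional wave
    whose phase has absorbed [<p, m>] over the other coordinates. *)
Lemma integral_gauss_wave n (m p : 'I_n -> R) s c : s != 0 ->
  (\int[lebesgue_tuple R n]_t (gauss_wave m p s c t)%:E =
  ((normal_peak s)^-1 ^+ n * expR (- (s ^+ 2 * (\sum_(i < n) p i ^+ 2) / 2)) *
   cos (\sum_(i < n) p i * m i + c))%:E)%E.
Proof.
move=> s0; elim: n m p c => [|n IHn] m p c.
  rewrite integral_dirac//; last first.
    apply/measurable_EFinP; exact: measurable_gauss_wave.
  rewrite diracT mul1e /gauss_wave !big_ord0 expr0.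
  by rewrite mulr0 mul0r oppr0 expR0 mulr1.
rewrite integral_lebesgue_tupleS; last 2 first.
- exact: measurable_gauss_wave.
- exact/integrable_gauss_wave_cons/integrable_gauss_wave.
under eq_integral => x _.
  under eq_integral do rewrite gauss_wave_cons EFinM.
  rewrite integralZl//; last exact: integrable_gauss_wave.
  rewrite IHn -EFinM mulrCA EFinM addrCA; over.
rewrite integralZl//=; last exact: integrable_normal_cos.
rewrite integral_normal_cos//.
rewrite -EFinM !big_ord_recl (exprS _^-1) mulrDr mulrDl opprD expRD.
congr EFin.
rewrite addrA; ring.
Qed.

End gaussian_tuple.

(** * Scalar product and complex structure *)

Section euclidean.
Context {R : realType} {n : nat}.
Implicit Types v w u p m : 'cV[R]_n.

Lemma scalar_productC v w : scalar_product v w = scalar_product w v.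
Proof. by rewrite /scalar_product -[w^T *m v]trmxK trmx_mul trmxK [RHS]mxE. Qed.

Lemma scalar_productDl v w u :
  scalar_product (v + w) u = scalar_product v u + scalar_product w u.
Proof. by rewrite /scalar_product linearD mulmxDl mxE. Qed.

Lemma scalar_productDr v w u :
  scalar_product u (v + w) = scalar_product u v + scalar_product u w.
Proof. by rewrite /scalar_product mulmxDr mxE. Qed.

Lemma scalar_productZl (k : R) v w :
  scalar_product (k *: v) w = k * scalar_product v w.
Proof. by rewrite /scalar_product linearZ -scalemxAl mxE. Qed.

Lemma scalar_productZr (k : R) v w :
  scalar_product w (k *: v) = k * scalar_product w v.
Proof. by rewrite scalar_productC scalar_productZl scalar_productC. Qed.

Lemma scalar_productNl v w : scalar_product (- v) w = - scalar_product v w.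
Proof. by rewrite -scaleN1r scalar_productZl mulN1r. Qed.

Lemma scalar_productNr v w : scalar_product w (- v) = - scalar_product w v.
Proof. by rewrite scalar_productC scalar_productNl scalar_productC. Qed.

Definition scalar_product_linear := (scalar_productDl, scalar_productDr,
  scalar_productNl, scalar_productNr, scalar_productZl, scalar_productZr).

Lemma scalar_productE v w : scalar_product v w = \sum_(i < n) v i 0 * w i 0.
Proof. by rewrite /scalar_product mxE; apply: eq_bigr => i _; rewrite mxE. Qed.

Lemma sqnormB v w :
  sqnorm (v - w) = sqnorm v - 2 * scalar_product v w + sqnorm w.
Proof.
rewrite /sqnorm !scalar_product_linear (scalar_productC w v); ring.
Qed.

Lemma sqnormZ (k : R) v : sqnorm (k *: v) = k ^+ 2 * sqnorm v.
Proof. by rewrite /sqnorm !scalar_product_linear mulrA. Qed.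

(** Median identity: [w] enters only through its distance to the midpoint. *)
Lemma sqnorm_midpoint v w u :
  sqnorm (v - w) + sqnorm (w - u) =
  2 * sqnorm (w - 2^-1 *: (v + u)) + sqnorm (v - u) / 2.
Proof.
rewrite !sqnormB sqnormZ /sqnorm !scalar_product_linear.
rewrite (scalar_productC w v) (scalar_productC u v).
by field.
Qed.

End euclidean.

Section complex_structure.
Context {R : realType} {n : nat} (J : 'M[R]_n).
Hypotheses (J_sqr : J *m J = - 1%:M) (J_tr : J^T = - J).
Implicit Types v w : 'cV[R]_n.

Lemma omegaC v w : omega J v w = - omega J w v.
Proof.
rewrite /omega [in RHS]scalar_productC /scalar_product trmx_mul J_tr.
by rewrite mulmxN mulNmx mxE mulmxA.
Qed.

Lemma omegaxx v : omega J v v = 0.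
Proof. by have := omegaC v v; lra. Qed.

Lemma sqnormJ v : sqnorm (J *m v) = sqnorm v.
Proof.
rewrite /sqnorm /scalar_product trmx_mul J_tr mulmxN mulNmx.
by rewrite mulmxA -(mulmxA _ J J) J_sqr mulmxN mulmx1 mulNmx opprK.
Qed.

End complex_structure.

(** * Gaussian integrals over column vectors *)

Section gaussian_column.
Context {R : realType}.

Lemma expRM_sqnorm n (m : 'cV[R]_n) (a : R) (t : n.-tuple R) : 0 < a ->
  expR (- (sqnorm (col_of_tuple t - m) / (2 * a))) =
  \prod_(i < n) normal_fun (m i 0) (Num.sqrt a) (tnth t i).
Proof.
move=> a0; rewrite /normal_fun -expR_sum; congr expR.
rewrite /sqnorm scalar_productE mulr_suml -sumrN.
apply: eq_bigr => i _; rewrite !mxE sqr_sqrtr ?ltW// mulr_natl.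
by rewrite -expr2 mulNr.
Qed.

Lemma normal_peakV_even n (a : R) : 0 < a -> ~~ odd n ->
  (normal_peak (Num.sqrt a))^-1 ^+ n = (2 * pi * a) ^+ n./2.
Proof.
move=> a0 n_even; rewrite /normal_peak invrK sqr_sqrtr ?ltW//.
rewrite -[in LHS](even_halfK n_even) -mul2n exprM sqr_sqrtr.
  by congr (_ ^+ _); ring.
by rewrite mulrn_wge0// mulr_ge0 ?pi_ge0// ltW.
Qed.

(** Up to the factor [exp k], the real part of the integrand is a Gaussian wave
    of phase [0] and its imaginary part one of phase [- pi / 2].  The parameter
    [k] collects what is left over when a square is completed. *)
Lemma cintegral_gauss n (m p : 'cV[R]_n) (a k : R) (F : 'cV[R]_n -> R[i]) :
  0 < a -> ~~ odd n ->
  (forall v, F v = cexp (Complex (k - sqnorm (v - m) / (2 * a))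
                                 (scalar_product p v))) ->
  cintegrable F /\
  cintegral F = ((2 * pi * a) ^+ n./2)%:C%C *
    cexp (Complex (k - a / 2 * sqnorm p) (scalar_product p m)).
Proof.
move=> a0 n_even FE.
have sa0 : Num.sqrt a != 0 by rewrite gt_eqF// sqrtr_gt0.
pose W c := gauss_wave (fun i => m i 0) (fun i => p i 0) (Num.sqrt a) c.
have WE c t : expR (k - sqnorm (col_of_tuple t - m) / (2 * a)) *
    cos (scalar_product p (col_of_tuple t) + c) = expR k * W c t.
  rewrite expRD -mulrA expRM_sqnorm// /W /gauss_wave scalar_productE.
  by congr (_ * (_ * cos (_ + _))); apply: eq_bigr => i _; rewrite mxE.
have FRe t : complex.Re (F (col_of_tuple t)) = expR k * W 0 t.
  by rewrite FE /= -WE addr0.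
have FIm t : complex.Im (F (col_of_tuple t)) = expR k * W (- (pi / 2)) t.
  by rewrite FE /= -WE sin_cos_shift.
have iW c : (lebesgue_tuple R n).-integrable setT
      (fun t => (expR k * W c t)%:E).
  exact: (integrableZl measurableT _ (integrable_gauss_wave _ _ c sa0)).
have intW c : \int[lebesgue_tuple R n]_t (expR k * W c t) =
    (2 * pi * a) ^+ n./2 * (expR (k - a / 2 * sqnorm p) *
    cos (scalar_product p m + c)).
  rewrite RintegralZl//; last exact: (integrable_gauss_wave _ _ c sa0).
  rewrite /Rintegral integral_gauss_wave//= normal_peakV_even// expRD.
  rewrite sqr_sqrtr ?ltW// -!scalar_productE -/(sqnorm p).
  rewrite (_ : a * sqnorm p / 2 = a / 2 * sqnorm p); first by ring.
  by rewrite mulrAC.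
split.
  by split; [under eq_fun do rewrite FRe|under eq_fun do rewrite FIm].
apply/eqP; rewrite /cintegral eq_complex /=; apply/andP; split; apply/eqP.
  under eq_Rintegral do rewrite FRe.
  by rewrite intW addr0 mul0r subr0.
under eq_Rintegral do rewrite FIm.
by rewrite intW mul0r addr0 -sin_cos_shift.
Qed.

(** The common shape of the three exponents: [o] is the symplectic part of the
    phase function and [q] its sum of squared distances. *)
Lemma phaseE (h o q : R) : h != 0 ->
  - ('i / h%:C%C) * (o%:C%C - 'i / 2 * q%:C%C) =
  Complex (- (q / (2 * h))) (- (o / h)) :> R[i].
Proof.
move=> h0; rewrite [RHS]complexE /= complexiE.
have hC : h%:C%C != 0 :> R[i] by rewrite (inj_eq (@complexI _)).
have -> : - ('i / h%:C%C) * (o%:C%C - 'i / 2 * q%:C%C) =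
   'i ^+ 2 * (q%:C%C / (2 * h%:C%C)) - 'i * (o%:C%C / h%:C%C) :> R[i].
  by field.
rewrite sqrCi !rmorphN /= !rmorphM/= !fmorphV/= !rmorphM/= rmorph_nat.
by rewrite mulN1r mulrN.
Qed.

End gaussian_column.

(** * The three phase integrals *)

Theorem proposition8p1 (R : realType) (hbar : R) (n : nat) (J : 'M[R]_n)
    (hbar_gt0 : 0 < hbar) (n_gt0 : (0 < n)%N) (n_even : ~~ odd n)
    (J_sqr : J *m J = - 1%:M) (J_tr : J^T = - J) :
  [/\ (forall w : 'cV[R]_n,
         let F (v : 'cV[R]_n) := cexp (- ('i / hbar%:C%C) * g1 J v w) in
         cintegrable F /\
         cintegral F =
           ((2 * pi * hbar) ^+ n./2 * expR (- (1 / (2 * hbar)) * sqnorm w))%:C%C),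
      (forall w u : 'cV[R]_n,
         let F (v : 'cV[R]_n) := cexp (- ('i / hbar%:C%C) * g2 J v w u) in
         cintegrable F /\
         cintegral F =
           ((2 * pi * hbar) ^+ n./2
            * expR (- (1 / (2 * hbar)) * sqnorm (w + u)))%:C%C) &
      (forall v u : 'cV[R]_n,
         let F (w : 'cV[R]_n) := cexp (- ('i / hbar%:C%C) * g3 J v w u) in
         cintegrable F /\
         cintegral F =
           ((pi * hbar) ^+ n./2)%:C%C
           * cexp (- ('i / hbar%:C%C) * g1 J v u))].
Proof.
have h0 : hbar != 0 by rewrite gt_eqF.
split.
- move=> w F.
  have [|iF ->] := @cintegral_gauss _ n w (hbar^-1 *: (J *m w)) hbar 0 F
    hbar_gt0 n_even.
    move=> v; rewrite /F /g1 phaseE// omegaC// sub0r mulNr opprK.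
    by rewrite scalar_productZl [_ / hbar]mulrC.
  split=> //.
  rewrite sqnormZ sqnormJ// scalar_productZl -/(omega J w w) omegaxx// mulr0.
  apply/eqP; rewrite eq_complex /= cos0 sin0 !(mulr0, mul0r) mulr1.
  rewrite subr0 addr0 eqxx andbT.
  apply/eqP; congr (_ * expR _); by field.
- move=> w u F.
  have [|iF ->] := @cintegral_gauss _ n 0 (- hbar^-1 *: (J *m (w + u))) hbar 0 F
    hbar_gt0 n_even.
    move=> v; rewrite /F /g2 -rmorphN phaseE// omegaC// sub0r subr0 opprK.
    by rewrite scalar_productZl mulNr [_ / hbar]mulrC.
  split=> //.
  rewrite sqnormZ sqnormJ// (_ : scalar_product _ 0 = 0); last first.
    by rewrite /scalar_product mulmx0 mxE.
  apply/eqP; rewrite eq_complex /= cos0 sin0 !(mulr0, mul0r) mulr1.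
  rewrite subr0 addr0 eqxx andbT.
  apply/eqP; congr (_ * expR _); by field.
- move=> v u F.
  have a0 : 0 < hbar / 2 by rewrite divr_gt0.
  have [|iF ->] := @cintegral_gauss _ n (2^-1 *: (v + u))
    (- hbar^-1 *: (J *m (v - u))) (hbar / 2)
    (- (sqnorm (v - u) / (4 * hbar))) F a0 n_even.
    move=> w; rewrite /F.
    have -> : g3 J v w u = (omega J v w + omega J w u)%:C%C
        - 'i / 2 * (sqnorm (v - w) + sqnorm (w - u))%:C%C.
      by rewrite /g3 !rmorphD mulrDr opprD addrA.
    have omegaE : omega J v w + omega J w u = scalar_product (J *m (v - u)) w.
      by rewrite [omega J w u]omegaC// mulmxBr !scalar_product_linear.
    rewrite phaseE// sqnorm_midpoint omegaE scalar_productZl.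
    set q := sqnorm (w - _); set q' := sqnorm (v - u).
    set o := scalar_product _ _.
    have -> : - ((2 * q + q' / 2) / (2 * hbar)) =
        - (q' / (4 * hbar)) - q / (2 * (hbar / 2)) by field.
    by rewrite mulNr (mulrC o).
  split=> //; rewrite /g1 phaseE//; congr (_%:C%C * cexp (Complex _ _)).
  - by congr (_ ^+ _); field.
  - by rewrite sqnormZ sqnormJ//; field.
  - rewrite mulmxBr !scalar_product_linear -!/(omega _ _ _) !omegaxx//.
    rewrite (omegaC J_tr u v).
    by field.
Qed.
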